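(* Let $n\ge1$, let $\mathcal{B}_1,\mathcal{B}_2$ be non-trivial Boolean algebras and let $h:\mathcal{A}^{\mathcal{B}_1}_{C_n}\to\mathcal{A}^{\mathcal{B}_2}_{C_n}$ be a homomorphism of $\Sigma$-multialgebras. Then there exists a function $g:|\mathcal{B}_1|\to|\mathcal{B}_2|$ such that $h(z)_{[1]}=g(z_{[1]})$ and $h(z)_{[2]}=g(z_{[2]})$ for every $z\in B^{\mathcal{B}_1}_n$.
   Context: $\Sigma$ is the signature with unary $\neg$ and binary $\wedge,\vee,\to$. For a non-trivial Boolean algebra $\mathcal{B}$ (complement $\sim$, $a\to b=\sim a\vee b$), $n\ge1$, and $z\in|\mathcal{B}|^{n+1}$ with coordinates $z_{[i]}$: $B^{\mathcal{B}}_n=\{z: (\bigwedge_{i=1}^k z_{[i]})\vee z_{[k+1]}=1 \ \forall 1\le k\le n\}$, $Boo^{\mathcal{B}}_n=\{z\in B^{\mathcal{B}}_n:z_{[1]}\wedge z_{[2]}=0\}$. $\mathcal{A}^{\mathcal{B}}_{C_n}$ is the $\Sigma$-multialgebra on $B^{\mathcal{B}}_n$ with $\tilde\neg z=\{w\in B^{\mathcal{B}}_n: w_{[1]}=z_{[2]}, w_{[2]}\le z_{[1]}\}$ and for $\#\in\{\wedge,\vee,\to\}$, $z\tilde\# w=\{u\in Boo^{\mathcal{B}}_n:u_{[1]}=z_{[1]}\#w_{[1]}\}$ if $z,w\in Boo^{\mathcal{B}}_n$, else $\{u\in B^{\mathcal{B}}_n:u_{[1]}=z_{[1]}\#w_{[1]}\}$.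 A homomorphism of $\Sigma$-multialgebras $h$ satisfies $h[\tilde\neg z]\subseteq\tilde\neg h(z)$ and $h[z\tilde\#w]\subseteq h(z)\tilde\#h(w)$ for all $z,w$ and $\#$. *)

(* Defs.v *)
From HB Require Import structures.
From mathcomp Require Import all_boot all_order.
From mathcomp Require Import boolp classical_sets.

Set Implicit Arguments.
Unset Strict Implicit.
Unset Printing Implicit Defensive.

Import Order.Theory.
Local Open Scope classical_set_scope.

Inductive binop := And | Or | Imp.

Record multialgebra := Multialgebra {
  carrier :> Type;
  mneg : carrier -> set carrier;
  mbin : binop -> carrier -> carrier -> set carrier;
  mneg_nonempty : forall x, mneg x !=set0;
  mbin_nonempty : forall c x y, mbin c x y !=set0 }.

Definition multialgebra_hom (A A' : multialgebra) (h : A -> A') : Prop :=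
  (forall z, h @` mneg z `<=` mneg (h z)) /\
  (forall c z w, h @` mbin c z w `<=` mbin c (h z) (h w)).

Section SwapStructure.
Variables (d : Order.disp_t) (B : ctbDistrLatticeType d) (n : nat).
Local Open Scope order_scope.

Definition bool_op (c : binop) (a b : B) : B :=
  match c with
  | And => a `&` b
  | Or => a `|` b
  | Imp => ~` a `|` b
  end.

(* Coordinates are numbered from 1; the default value \bot is only reached
   outside the range 1 <= i <= n + 1. *)
Definition coord (z : n.+1.-tuple B) (i : nat) : B := nth \bot z i.-1.

Definition in_Bn (z : n.+1.-tuple B) : bool :=
  all (fun k => (\meet_(1 <= i < k.+1) coord z i) `|` coord z k.+1 == \top)
      (iota 1 n).

Definition Bn : Type := {z : n.+1.-tuple B | in_Bn z}.

Definition Bcoord (z : Bn) (i : nat) : B := coord (val z) i.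

Definition in_Boo (z : Bn) : bool := Bcoord z 1 `&` Bcoord z 2 == \bot.

Definition Cn_neg (z : Bn) : set Bn :=
  [set w | Bcoord w 1 = Bcoord z 2 /\ Bcoord w 2 <= Bcoord z 1].

Definition Cn_bin (c : binop) (z w : Bn) : set Bn :=
  if in_Boo z && in_Boo w
  then [set u | in_Boo u /\ Bcoord u 1 = bool_op c (Bcoord z 1) (Bcoord w 1)]
  else [set u | Bcoord u 1 = bool_op c (Bcoord z 1) (Bcoord w 1)].

Let pad (a b : B) : n.+1.-tuple B :=
  [tuple nth \top [:: a; b] i | i < n.+1].

Let pad_coord a b i : (i <= n)%N ->
  coord (pad a b) i.+1 = nth \top [:: a; b] i.
Proof.
move=> lin; pose j := Ordinal (lin : (i < n.+1)%N).
by rewrite /coord -[i.+1.-1]/(val j) -tnth_nth tnth_mktuple.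
Qed.

Let pad_in a b : a `|` b = \top -> in_Bn (pad a b).
Proof.
move=> ab; apply/allP => -[|[|k]]; rewrite mem_iota // add1n ltnS => /= kn.
  by rewrite big_nat1 !pad_coord //= ab.
by rewrite pad_coord //= nth_nil joinx1.
Qed.

Lemma Cn_neg_nonempty z : Cn_neg z !=set0.
Proof.
have [n0|n_gt0] := posnP n.
  have zt : in_Bn (pad \bot \top) by apply: pad_in; rewrite joinx1.
  exists (exist (fun t => is_true (in_Bn t)) _ zt); rewrite /Cn_neg /= /Bcoord /= pad_coord //=.
  by split; rewrite /coord nth_default // size_tuple n0.
have h : Bcoord z 2 `|` Bcoord z 1 = \top.
  case: z => z zP; rewrite /Bcoord /= joinC.
  move/allP: zP => /(_ 1%N); rewrite mem_iota add1n !ltnS n_gt0 => /(_ isT).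
  by rewrite big_nat1 => /eqP.
by exists (exist (fun t => is_true (in_Bn t)) _ (pad_in h)); rewrite /Cn_neg /Bcoord /= !pad_coord.
Qed.

Lemma Cn_bin_nonempty c z w : Cn_bin c z w !=set0.
Proof.
set a := bool_op c (Bcoord z 1) (Bcoord w 1).
have h : a `|` ~` a = \top by rewrite joinxC.
have h1 : Bcoord (exist (fun t => is_true (in_Bn t)) _ (pad_in h)) 1 = a.
  by rewrite /Bcoord /= pad_coord.
exists (exist (fun t => is_true (in_Bn t)) _ (pad_in h)); rewrite /Cn_bin; case: ifP => _ //=.
split=> //; rewrite /in_Boo h1 /Bcoord /=.
have [n0|n_gt0] := posnP n.
  by rewrite [coord _ 2]nth_default ?meetx0 // size_tuple n0.
by rewrite pad_coord //= meetxC.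
Qed.

Definition A_Cn : multialgebra :=
  Multialgebra Cn_neg_nonempty Cn_bin_nonempty.

End SwapStructure.

(* Main.v *)
Require Import Defs.
From HB Require Import structures.
From mathcomp Require Import all_boot all_order.
From mathcomp Require Import boolp classical_sets.

Set Implicit Arguments.
Unset Strict Implicit.
Unset Printing Implicit Defensive.

Import Order.Theory.

(* The tuple (1, ..., 1) is not in Boo because the algebra is non-trivial, so
   its conjunction with (a, 1, ..., 1) is the set of all z with z_[1] = a.  Hence
   h(z)_[1] depends only on z_[1].  Any w in the negation of z has
   w_[1] = z_[2] and h(w)_[1] = h(z)_[2], which gives the second coordinate. *)

Section TopTail.
Variables (d : Order.disp_t) (B : ctbDistrLatticeType d) (n : nat).
Local Open Scope order_scope.

(** Each condition joins a meet with a coordinate of index at least 2, and that coordinate is [\top]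
    here. *)
Lemma in_Bn_top_tail (a : B) : in_Bn [tuple of a :: nseq n \top].
Proof.
apply/allP => -[|k]; rewrite mem_iota // add1n !ltnS => /= kn.
by rewrite [coord _ k.+2]/coord /= nth_nseq kn joinx1.
Qed.

Definition top_tail (a : B) : Bn B n :=
  exist (fun t => is_true (in_Bn t)) _ (in_Bn_top_tail a).

Lemma top_tail1 (a : B) : Bcoord (top_tail a) 1 = a.
Proof. by []. Qed.

(** Since [0 < n], coordinate 2 lies inside the tuple and is [\top] rather than the default [\bot],
    so the first two coordinates meet in [\top]. *)
Lemma top_tail_top_notin_Boo :
  (0 < n)%N -> (\bot : B) <> \top -> in_Boo (top_tail \top) = false.
Proof.
move=> n_gt0 nontriv; apply/eqP.
by rewrite top_tail1 meet1x /Bcoord /coord /= nth_nseq n_gt0 => /esym.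
Qed.

Lemma mem_And_top_tail (z : Bn B n) :
  (0 < n)%N -> (\bot : B) <> \top ->
  Cn_bin And (top_tail \top) (top_tail (Bcoord z 1)) z.
Proof.
move=> n_gt0 nontriv.
by rewrite /Cn_bin top_tail_top_notin_Boo //= !top_tail1 meet1x.
Qed.

End TopTail.

Theorem theorem6p4 (n : nat) (hn : (1 <= n)%N)
    (d1 d2 : Order.disp_t)
    (B1 : ctbDistrLatticeType d1) (B2 : ctbDistrLatticeType d2)
    (nontriv1 : (\bot : B1)%O <> (\top : B1)%O)
    (nontriv2 : (\bot : B2)%O <> (\top : B2)%O)
    (h : A_Cn B1 n -> A_Cn B2 n) (hom_h : multialgebra_hom h) :
  exists g : B1 -> B2, forall z : Bn B1 n,
    Bcoord (h z) 1 = g (Bcoord z 1) /\ Bcoord (h z) 2 = g (Bcoord z 2).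
Proof.
have [h_neg h_bin] := hom_h.
have h1 (z : Bn B1 n) : Bcoord (h z) 1 =
    (Bcoord (h (top_tail n \top%O)) 1 `&`
     Bcoord (h (top_tail n (Bcoord z 1))) 1)%O.
  have : mbin And (h (top_tail n \top%O)) (h (top_tail n (Bcoord z 1))) (h z).
    by apply: h_bin; exists z => //; exact: mem_And_top_tail.
  (* Whether or not both images lie in Boo, membership forces the first coordinate to be this
     meet. *)
  by rewrite /= /Cn_bin; case: ifP => _ // -[].
exists (fun a => Bcoord (h (top_tail n \top%O)) 1 `&`
                 Bcoord (h (top_tail n a)) 1)%O => z; split; first exact: h1.
have [w zw] := Cn_neg_nonempty z.
have [<- _] : Cn_neg (h z) (h w) by apply: h_neg; exists w.
(* [h1] is used at [w], whose first coordinate is the second one of [z]; hence the same function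
   serves both coordinates. *)
by rewrite h1; case: zw => ->.
Qed.
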